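(* Let $p$ be a prime, $s\ge0$, $r\ge1$ and $\alpha_1,\dots,\alpha_r\ge1$ integers, and $A=\mathbb{Z}_{p^{\alpha_1}}\oplus\cdots\oplus\mathbb{Z}_{p^{\alpha_r}}$. Then $$\mathsf{D}_{p^s}(A)=p^s\Big(\sum_{i=1}^r(p^{\alpha_i}-1)+1\Big)=p^s\,\mathsf{D}(A),$$ where $\mathsf{D}(A)$ is the Davenport constant of the additive group of $A$.
   Context: For a finite commutative ring $A$, a sequence over $A$ is a finite multiset of elements of $A$; its length counts multiplicity, and a subsequence is a sub-multiset. For $S=(a_1,\dots,a_\ell)$ and $m\ge1$, $e_m(S)=\sum_{1\le i_1<\dots<i_m\le \ell}\prod_{j=1}^m a_{i_j}$. $\mathsf{D}_m(A)$ is the smallest positive integer $t$ such that every sequence $S$ over $A$ with $|S|\ge t$ contains a subsequence $S'$ with $|S'|\ge m$ and $e_m(S')=0$. The Davenport constant $\mathsf{D}(G)$ of a finite abelian group $G$ is the smallest positive integer $t$ such that every sequence over $G$ of length at least $t$ has a non-empty zero-sum subsequence. Ring operations on $A$ are componentwise. *)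

(* Defs.v *)
From HB Require Import structures.
From mathcomp Require Import all_boot all_algebra.
From mathcomp Require Import boolp.

Set Implicit Arguments.
Unset Strict Implicit.
Unset Printing Implicit Defensive.

Import GRing.Theory.

Local Open Scope ring_scope.

(* Finite direct sum of rings, with componentwise operations. MathComp only
   provides the algebraic structures of non-dependent finite functions, hence
   the alias. The empty sum is the zero ring, so the result is only a
   finComPzRingType. *)
Definition dsum_ring (I : finType) (R : I -> finComPzRingType) : Type :=
  {dffun forall i, R i}.

Section DirectSumRing.
Variables (I : finType) (R : I -> finComPzRingType).
Implicit Types f g h : {dffun forall i, R i}.

Definition dsum_add f g : {dffun forall i, R i} := [ffun i => f i + g i].
Definition dsum_opp f : {dffun forall i, R i} := [ffun i => - f i].
Definition dsum_zero : {dffun forall i, R i} := [ffun i => 0].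
Definition dsum_mul f g : {dffun forall i, R i} := [ffun i => f i * g i].
Definition dsum_one : {dffun forall i, R i} := [ffun i => 1].

Fact dsum_addA : associative dsum_add.
Proof. by move=> f g h; apply/ffunP=> i; rewrite !ffunE addrA. Qed.
Fact dsum_addC : commutative dsum_add.
Proof. by move=> f g; apply/ffunP=> i; rewrite !ffunE addrC. Qed.
Fact dsum_add0 : left_id dsum_zero dsum_add.
Proof. by move=> f; apply/ffunP=> i; rewrite !ffunE add0r. Qed.
Fact dsum_addN : left_inverse dsum_zero dsum_opp dsum_add.
Proof. by move=> f; apply/ffunP=> i; rewrite !ffunE addNr. Qed.
Fact dsum_mulA : associative dsum_mul.
Proof. by move=> f g h; apply/ffunP=> i; rewrite !ffunE mulrA. Qed.
Fact dsum_mulC : commutative dsum_mul.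
Proof. by move=> f g; apply/ffunP=> i; rewrite !ffunE mulrC. Qed.
Fact dsum_mul1 : left_id dsum_one dsum_mul.
Proof. by move=> f; apply/ffunP=> i; rewrite !ffunE mul1r. Qed.
Fact dsum_mul1r : right_id dsum_one dsum_mul.
Proof. by move=> f; rewrite dsum_mulC dsum_mul1. Qed.
Fact dsum_mulDl : left_distributive dsum_mul dsum_add.
Proof. by move=> f g h; apply/ffunP=> i; rewrite !ffunE mulrDl. Qed.
Fact dsum_mulDr : right_distributive dsum_mul dsum_add.
Proof. by move=> f g h; rewrite !(dsum_mulC f) dsum_mulDl. Qed.

HB.instance Definition _ := Finite.on (dsum_ring R).
HB.instance Definition _ := GRing.isZmodule.Build (dsum_ring R)
  dsum_addA dsum_addC dsum_add0 dsum_addN.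
HB.instance Definition _ := GRing.Zmodule_isPzRing.Build (dsum_ring R)
  dsum_mulA dsum_mul1 dsum_mul1r dsum_mulDl dsum_mulDr.
HB.instance Definition _ :=
  GRing.PzRing_hasCommutativeMul.Build (dsum_ring R) dsum_mulC.

End DirectSumRing.

(* The least positive t satisfying P, or 0 when there is none; in particular
   an equation least_pos P = n with n > 0 entails that the minimum exists. *)
Definition least_pos (P : nat -> Prop) : nat :=
  if pselect (exists t, (0 < t)%N && `[< P t >]) is left exP
  then ex_minn exP else 0%N.

Lemma least_posP (P : nat -> Prop) (n : nat) : (0 < n)%N ->
  least_pos P = n <-> P n /\ (forall t, (0 < t)%N -> P t -> (n <= t)%N).
Proof.
move=> n_gt0; rewrite /least_pos; case: pselect => [exP|nexP]; last first.
  split=> [n0|[Pn _]]; first by rewrite -n0 in n_gt0.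
  by case: nexP; exists n; rewrite n_gt0; apply/asboolP.
case: ex_minnP => m /andP[m_gt0 /asboolP Pm] min_m; split=> [<-|[Pn min_n]].
  by split=> // t t_gt0 Pt; apply: min_m; rewrite t_gt0; apply/asboolP.
apply/eqP; rewrite eqn_leq min_n // andbT.
by apply: min_m; rewrite n_gt0; apply/asboolP.
Qed.

(* A finite multiset over A is represented by any list of its elements. Size,
   esym and sums do not depend on the order of the list, and up to reordering
   the lists S' with subseq S' S are exactly the sub-multisets of S
   (count_subseqP). *)

(* Increasing tuples of m indices are encoded as sets of m indices. *)
Definition esym (A : comPzRingType) (m : nat) (S : seq A) : A :=
  \sum_(J : {set 'I_(size S)} | #|J| == m) \prod_(j in J) S`_j.

Definition davenport_esym (m : nat) (A : finComPzRingType) : nat :=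
  least_pos (fun t => forall S : seq A, (t <= size S)%N ->
    exists S' : seq A, [/\ subseq S' S, (m <= size S')%N & esym m S' = 0]).

Definition davenport (G : finZmodType) : nat :=
  least_pos (fun t => forall S : seq G, (t <= size S)%N ->
    exists S' : seq G, [/\ subseq S' S, S' != [::] & \sum_(x <- S') x = 0]).

(* Main.v *)
(** Write m = p^s and q_i = p^alpha_i.

    Upper bound (Olson's polynomial method). The sub-multisets of a sequence
    of length n correspond to the subsets J of its index set I. Let e_i(J) be
    the value of e_m on J in the i-th component, lifted to a natural number.
    Then P(J) = C(|J| + m - 1, m - 1) * prod_i C(e_i(J) + q_i - 1, q_i - 1) is
    a polynomial of degree at most m - 1 + sum_i m (q_i - 1) < n in the
    indicator of J, so the sum of (-1)^|J| P(J) over all J vanishes. Since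
    P(empty) = 1, some nonempty J has P(J) prime to p, which forces m to
    divide |J| and q_i to divide e_i(J).

    Lower bound. Take nested 0/1 vectors v_0 = 1, v_1, ..., v_r, where v_j
    vanishes exactly on the first j - 1 components, v_0 with multiplicity
    m - 1 and v_(i+1) with multiplicity m (q_i - 1). For a sub-multiset, e_m in
    the i-th component is C(k_i, m), where k_i counts the chosen v_j with
    j <= i + 1. By Legendre's formula, q_i divides C(k_i, m) only if k_i < m or
    k_i >= m q_i; by induction on i the second case never occurs, so in the end
    fewer than m vectors are chosen.

    The Davenport constant is the case s = 0. *)
Require Import Defs.
From mathcomp Require Import all_boot all_algebra.
From mathcomp Require Import zify.

Set Implicit Arguments.
Unset Strict Implicit.
Unset Printing Implicit Defensive.

Import GRing.Theory.

(** * Polynomials in the indicator of a set, and their degree *)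

Section SetDegree.
Variable I : finType.
Implicit Types (d q : nat) (g h : {set I} -> nat) (J K : {set I}).

(* g is a natural combination of the monomials J |-> [K \subset J] with
   #|K| <= d, written as a list with repetitions. *)
Definition set_degree d g : Prop :=
  exists2 s : seq {set I}, all (fun K => #|K| <= d) s &
    forall J, g J = count (fun K => K \subset J) s.

Lemma set_degree_const d c : set_degree d (fun=> c).
Proof.
exists (nseq c set0) => [|J]; first by rewrite all_nseq cards0 orbT.
by rewrite count_nseq sub0set mul1n.
Qed.

Lemma set_degree_subset K : set_degree #|K| (fun J => K \subset J).
Proof. by exists [:: K] => [|J] /=; rewrite ?leqnn ?addn0. Qed.

Lemma set_degree_le d d' g : d <= d' -> set_degree d g -> set_degree d' g.
Proof.
move=> le_dd' [s /allP sd gE]; exists s => //.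
by apply/allP=> K /sd /leq_trans->.
Qed.

Lemma set_degreeD d g h : set_degree d g -> set_degree d h ->
  set_degree d (fun J => g J + h J).
Proof.
move=> [s sd gE] [t td hE]; exists (s ++ t) => [|J]; first by rewrite all_cat sd.
by rewrite count_cat gE hE.
Qed.

(** The monomials of [K] and [L] multiply to the monomial of [K :|: L], which has at most
    [#|K| + #|L|] elements. *)
Lemma set_degreeM d d' g h : set_degree d g -> set_degree d' h ->
  set_degree (d + d') (fun J => g J * h J).
Proof.
move=> [s /allP sd gE] [t /allP td hE].
exists [seq K :|: L | K <- s, L <- t] => [|J].
  apply/allP=> _ /allpairsP[[K L] /= [/sd sK /td tL ->]].
  by rewrite (leq_trans (leq_card_setU K L)) // leq_add.
rewrite gE hE; elim: s {sd gE} => //= K s IHs.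
rewrite count_cat -IHs mulnDl; congr (_ + _).
rewrite count_map; have [sKJ|nsKJ] := boolP (K \subset J).
  by rewrite mul1n; apply: eq_count => L /=; rewrite subUset sKJ.
rewrite mul0n -(count_pred0 t); apply: eq_count => L /=.
by rewrite subUset (negPf nsKJ).
Qed.

Lemma set_degree_ext d g h : g =1 h -> set_degree d g -> set_degree d h.
Proof. by move=> gh [s sd gE]; exists s => // J; rewrite -gh. Qed.

Lemma set_degree_sum d (T : finType) (P : pred T) (F : T -> {set I} -> nat) :
  (forall x, P x -> set_degree d (F x)) ->
  set_degree d (fun J => \sum_(x | P x) F x J).
Proof.
move=> degF; elim: (index_enum T) => [|x s IHs].
  by apply: set_degree_ext (set_degree_const d 0) => J; rewrite big_nil.
case Px: (P x); last by apply: set_degree_ext IHs => J; rewrite big_cons Px.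
by apply: set_degree_ext (set_degreeD (degF x Px) IHs) => J; rewrite big_cons Px.
Qed.

Lemma set_degree_prod (T : finType) (e : T -> nat) (F : T -> {set I} -> nat) :
  (forall x, set_degree (e x) (F x)) ->
  set_degree (\sum_x e x) (fun J => \prod_x F x J).
Proof.
move=> degF; elim: (index_enum T) => [|x s IHs].
  by rewrite big_nil; apply: set_degree_ext (set_degree_const 0 1) => J; rewrite big_nil.
rewrite big_cons.
by apply: set_degree_ext (set_degreeM (degF x) IHs) => J; rewrite big_cons.
Qed.

(** Pascal's rule splits off one monomial of [g] at a time, so there is no division by the factorial
    of [q] and the coefficients stay natural. *)
Lemma set_degree_bin d q g : set_degree d g ->
  set_degree (d * q) (fun J => 'C(g J, q)).
Proof.
case=> s sd gE; apply: (@set_degree_ext _ (fun J => 'C(count (fun K => K \subset J) s, q))).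
  by move=> J; rewrite gE.
elim: s q sd {gE} => [|K s IHs] q /=; first by move=> _; apply: set_degree_const.
case/andP=> dK sd; case: q => [|q].
  by apply: set_degree_ext (set_degree_const _ 1) => J; rewrite bin0.
have degK := set_degree_le dK (set_degree_subset K).
rewrite mulnS.
apply: set_degree_ext (set_degreeD _ (set_degreeM degK (IHs q sd))) => [J|]; last first.
  by rewrite -mulnS; apply: (IHs q.+1 sd).
by case: (K \subset J); rewrite ?mul1n ?mul0n ?addn0 ?add0n // add1n binS.
Qed.

Local Open Scope ring_scope.

(* Toggling a point outside K reverses the sign. *)
Lemma alternating_sum_supsets K : K != [set: I] ->
  \sum_(J : {set I} | K \subset J) (-1) ^+ #|J| = 0 :> int.
Proof.
rewrite -subTset => /subsetPn[x _ xNK].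
pose h J := if x \in J then J :\ x else x |: J.
have hK : involutive h.
  move=> J; rewrite /h; case xJ: (x \in J); first by rewrite setD11 setD1K.
  by rewrite setU11 setU1K // xJ.
have hsub J : (K \subset h J) = (K \subset J).
  rewrite /h; case: ifP => xJ; first by rewrite subsetD1 xNK andbT.
  apply/idP/idP => [/subsetP sK|/subset_trans->//]; last exact: subsetUr.
  apply/subsetP=> y yK; have := sK y yK; rewrite in_setU1 => /predU1P[yx|//].
  by rewrite -yx yK in xNK.
have hsign J : (-1) ^+ #|h J| = - (-1) ^+ #|J| :> int.
  rewrite /h; case: ifP => xJ; last by rewrite cardsU1 xJ exprS mulN1r.
  by rewrite (cardsD1 x J) xJ exprS mulN1r opprK.
set s := LHS; suff : s = - s by lia.
rewrite {1}/s (reindex_inj (inv_inj hK)) -sumrN.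
by apply: eq_big => [J|J _]; rewrite ?hsub ?hsign.
Qed.

Lemma alternating_sum_set_degree d g : (d < #|I|)%N -> set_degree d g ->
  \sum_(J : {set I}) (-1) ^+ #|J| * (g J)%:R = 0 :> int.
Proof.
move=> dI [s /allP sd gE].
transitivity (\sum_(K <- s) \sum_(J : {set I} | K \subset J) (-1) ^+ #|J| : int).
  under [RHS]eq_bigr do rewrite big_mkcond.
  rewrite exchange_big; apply: eq_bigr => J _; rewrite gE -sum1_count natr_sum big_mkcond /=.
  by rewrite mulr_sumr; apply: eq_bigr => K _; case: ifP; rewrite ?mulr1 ?mulr0.
rewrite big_seq big1 // => K /sd Kd; apply: alternating_sum_supsets.
(* A monomial of degree less than [#|I|] cannot come from the full set. *)
by apply: contraTneq dI => KT; rewrite -leqNgt -cardsT -KT.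
Qed.

(** Otherwise every term of the vanishing alternating sum except the one at [set0] would be
    divisible by [p], hence that one too. *)
Lemma exists_ndvdn_set_degree d g p : (d < #|I|)%N -> set_degree d g ->
  ~~ (p %| g set0)%N -> exists2 J : {set I}, J != set0 & ~~ (p %| g J)%N.
Proof.
move=> dI degg Np; apply/exists_inP; apply: contraNT Np.
rewrite negb_exists_in => /forall_inP pg.
have := alternating_sum_set_degree dI degg.
rewrite (bigD1 set0) //= cards0 mul1r => /eqP; rewrite addr_eq0 => /eqP g0.
suff: (p%:Z %| (g set0)%:Z)%Z by rewrite dvdzE.
rewrite -[(g set0)%:Z]natz g0 rpredN; apply: rpred_sum => J /pg.
rewrite negbK => pgJ; apply: dvdz_mull; rewrite natz dvdzE //.
Qed.

End SetDegree.

(** * Binomial coefficients and prime powers *)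

(** With q = p^a, q C(n+q-1, q) = n C(n+q-1, q-1), and the last binomial is coprime to q. *)
Lemma dvdn_of_ndvdn_bin p a n : prime p ->
  ~~ (p %| 'C(n + (p ^ a - 1), p ^ a - 1)) -> p ^ a %| n.
Proof.
move=> p_pr Np; have pa_gt0 : 0 < p ^ a by rewrite expn_gt0 prime_gt0.
have := mul_bin_left (n + (p ^ a - 1)) (p ^ a - 1).
rewrite addnK subn1 prednK // => E.
have : p ^ a %| n * 'C(n + (p ^ a - 1), p ^ a - 1) by rewrite subn1 -E dvdn_mulr.
by rewrite Gauss_dvdl // coprimeXl // prime_coprime.
Qed.

(** A common range of summation lets Legendre's formula for several factorials be compared term by
    term. *)
Lemma logn_fact_wide p n N : prime p -> n <= N ->
  logn p n`! = \sum_(1 <= j < N.+1) n %/ p ^ j.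
Proof.
move=> p_pr nN; rewrite logn_fact // [RHS](big_cat_nat (n := n.+1)) //=.
rewrite [X in _ = _ + X]big1_seq ?addn0 // => j /andP[_].
rewrite mem_index_iota => /andP[nj _].
by rewrite divn_small // (ltn_trans nj) // ltn_expl // prime_gt1.
Qed.

Lemma pexp_leq_of_dvdn_bin p s a k : prime p -> p ^ s <= k -> p ^ a %| 'C(k, p ^ s) ->
  p ^ (s + a) <= k.
Proof.
move=> p_pr sk; have p_gt1 := prime_gt1 p_pr.
rewrite pfactor_dvdn ?bin_gt0 //; apply: contraTT; rewrite -!ltnNge => ka.
have a_gt0 : 0 < a by case: (a) ka => //; rewrite addn0 ltnNge sk.
have := congr1 (logn p) (bin_fact sk).
rewrite !lognM ?muln_gt0 ?fact_gt0 ?bin_gt0 //.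
rewrite !(@logn_fact_wide p _ k) ?leq_subr // -big_split /= => E.
(* In Legendre's formula, only the exponents strictly between s and s + a can
     carry, each at most once. *)
  suff : \sum_(1 <= j < k.+1) k %/ p ^ j <=
    \sum_(1 <= j < k.+1) (p ^ s %/ p ^ j + (k - p ^ s) %/ p ^ j) + a.-1.
  by rewrite -E; lia.
have : \sum_(1 <= j < k.+1) ((s < j) && (j < s + a)) <= a.-1.
  rewrite -big_mkcond /= sum1_count -size_filter -(size_iota s.+1 a.-1).
  apply: uniq_leq_size => [|j]; first by rewrite filter_uniq ?iota_uniq.
  by rewrite mem_filter mem_iota => /andP[]; lia.
move=> le_a; rewrite (leq_trans _ (leq_add (leqnn _) le_a)) // -big_split /=.
apply: leq_sum => j _.
have pj_gt0 : 0 < p ^ j by rewrite expn_gt0 ltnW.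
(* No carry for j <= s, since p^j divides p^s, nor for j >= s + a, since k < p^j. *)
have [js|sj] := leqP j s.
  by rewrite -{1}(subnKC sk) divnDl ?addn0 // dvdn_exp2l.
have [ja|aj] := ltnP j (s + a); last first.
  by rewrite divn_small // (leq_trans ka) // leq_exp2l.
rewrite -{1}(subnKC sk) divnD //=; lia.
Qed.

(** * Elementary symmetric functions of sequences *)

Section Esym.
Local Open Scope ring_scope.

(** Frees the index type from the literal [size S], so that sums over sequences of equal length
    share one index type. *)
Lemma esymE (A : comPzRingType) m n (S : seq A) : size S = n ->
  Defs.esym m S = \sum_(J : {set 'I_n} | #|J| == m) \prod_(j in J) S`_j.
Proof. by move=> <-. Qed.

(** Passes from positions in [t] to elements of [I]: without repetitions, [tnth] matches the two
    kinds of subsets. *)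
Lemma esym_map_uniq (A : comPzRingType) (I : finType) (F : I -> A) m (t : seq I) :
  uniq t -> Defs.esym m (map F t) =
    \sum_(K : {set I} | (K \subset t) && (#|K| == m)) \prod_(i in K) F i.
Proof.
move=> t_uniq; rewrite (esymE _ (size_map F t)).
pose u := tnth (in_tuple t).
have u_inj : injective u.
  by move=> i j /eqP; rewrite /u !(tnth_nth (u i)) nth_uniq // => /eqP/val_inj.
pose U (J : {set 'I_(size t)}) := u @: J.
pose V (K : {set I}) := [set j | u j \in K].
rewrite (reindex_onto U V) /=; last first.
  move=> K /andP[/subsetP sKt _]; apply/setP=> x; apply/imsetP/idP => [[j] | xK].
    by rewrite inE => uj ->.
  have /tnthP[j xE] : x \in in_tuple t by apply: sKt.
  by exists j; rewrite // inE /u -xE.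
apply: eq_big => [J|J _]; last first.
  rewrite big_imset /=; last by move=> i j _ _; apply: u_inj.
  by apply: eq_bigr => j _; rewrite (nth_map (u j)) // {2}/u (tnth_nth (u j)).
have -> : V (U J) = J by apply/setP=> j; rewrite inE mem_imset.
rewrite eqxx andbT card_imset // andb_idl // => _.
by apply/subsetP=> _ /imsetP[j _ ->]; apply: mem_tnth.
Qed.


(** A product is 1 when all its positions hold [true], and 0 otherwise. *)
Lemma esym_bool (A : comPzRingType) m (b : seq bool) :
  Defs.esym m [seq (nat_of_bool x)%:R : A | x <- b] = 'C(count id b, m)%:R.
Proof.
rewrite (esymE _ (size_map _ b)).
pose B := [set j : 'I_(size b) | nth false b j].
have -> : count id b = #|B|.
  by rewrite -sum1_count (big_nth false) big_mkord sum1dep_card.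
rewrite -cards_draws -sum1dep_card natr_sum.
rewrite [RHS](eq_bigl (fun J : {set _} => (#|J| == m) && (J \subset B))); last first.
  by move=> J; rewrite andbC.
rewrite [RHS]big_mkcondr; apply: eq_bigr => J _.
case: ifPn => [/subsetP sJB | /subsetPn[j jJ jNB]].
  rewrite big1 // => j /sJB; rewrite inE => bj.
  by rewrite (nth_map false) // bj.
rewrite (bigD1 j) //= (nth_map false) //; move: jNB; rewrite inE => /negPf->.
by rewrite mul0r.
Qed.

Lemma esym1 (A : comPzRingType) (S : seq A) : Defs.esym 1 S = \sum_(x <- S) x.
Proof.
rewrite /Defs.esym big_cards1 (big_nth 0) big_mkord.
by apply: eq_bigr => i _; rewrite big_set1.
Qed.

Section Component.
Variables (I : finType) (R : I -> finComPzRingType).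

Definition dsum_component (i : I) (x : dsum_ring R) : R i :=
  (x : {dffun forall i, R i}) i.

Lemma dsum_componentP (x y : dsum_ring R) :
  (forall i, dsum_component i x = dsum_component i y) -> x = y.
Proof. by move=> xy; apply/ffunP. Qed.

Lemma dsum_component0 i : dsum_component i 0 = 0.
Proof. exact: ffunE. Qed.

Lemma esym_component i m (S : seq (dsum_ring R)) :
  dsum_component i (Defs.esym m S) = Defs.esym m [seq dsum_component i x | x <- S].
Proof.
rewrite (esymE _ (size_map _ S)).
rewrite (big_morph (dsum_component i) (id1 := 0) (op1 := +%R)); first last.
- exact: dsum_component0.
- by move=> x y; apply: ffunE.
apply: eq_bigr => J _.
rewrite (big_morph (dsum_component i) (id1 := 1) (op1 := *%R)); first last.
- exact: ffunE.
- by move=> x y; apply: ffunE.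
by apply: eq_bigr => j _; rewrite (nth_map 0).
Qed.
End Component.
End Esym.

Lemma davenport_esym1 (A : finComPzRingType) : davenport_esym 1 A = davenport A.
Proof.
congr least_pos; apply: boolp.funext => t; apply: boolp.propext.
split=> H S /H[S' [sub nz S'0]]; exists S'; split=> //.
- by rewrite -size_eq0 -lt0n.
- by rewrite -esym1.
- by rewrite lt0n size_eq0.
- by rewrite esym1.
Qed.

(** The bound on [n] matters: ['Z_n] has n elements only when n > 1. *)
Lemma natr_Zp_eq0 n k : 1 < n -> (k%:R == 0 :> 'Z_n)%R = (n %| k).
Proof. by move=> n_gt1; rewrite -val_eqE /= val_Zp_nat. Qed.

(** * The upper bound *)

Section PrimePower.
Variables (p s r : nat) (alpha : 'I_r -> nat).
Hypotheses (p_pr : prime p) (alpha_gt0 : forall i : 'I_r, 0 < alpha i).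
Local Notation m := (p ^ s).
Local Notation q i := (p ^ alpha i).
Local Notation A :=
  (dsum_ring (fun i : 'I_r => ('Z_(p ^ alpha i) : finComPzRingType))).

Let q_gt1 i : 1 < q i.
Proof. by rewrite -{1}(expn0 p) ltn_exp2l ?prime_gt1. Qed.

Let m_gt0 : 0 < m.
Proof. by rewrite expn_gt0 prime_gt0. Qed.

Lemma exists_subseq_esym_eq0 (S : seq A) :
  m * (\sum_(i < r) (q i - 1) + 1) <= size S ->
  exists S' : seq A, [/\ subseq S' S, m <= size S' & Defs.esym m S' = 0%R].
Proof.
move=> leS; pose I := 'I_(size S).
pose a (i : 'I_r) (j : I) : nat := dsum_component i (S`_j)%R.
(* The factor [K \subset J] makes each term a constant times a monomial of degree m, whence degree m
   in [J]. *)
pose e i (J : {set I}) := \sum_(K : {set I} | #|K| == m) (K \subset J) * \prod_(j in K) a i j.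
have deg_e i : set_degree m (e i).
  apply: set_degree_sum => K /eqP Km; rewrite -[m]addn0.
  apply: set_degreeM (set_degree_const _ _ _); rewrite -Km; exact: set_degree_subset.
have deg_card : set_degree 1 (fun J : {set I} => #|J|).
  apply: (@set_degree_ext _ _ (fun J : {set I} => \sum_(j : I) ([set j] \subset J))).
    by move=> J; under eq_bigr do rewrite sub1set; rewrite -big_mkcond sum1_card.
  by apply: set_degree_sum => j _; rewrite -(cards1 j); exact: set_degree_subset.
pose P J := \prod_i 'C(e i J + (q i - 1), q i - 1) * 'C(#|J| + (m - 1), m - 1).
have deg_P : set_degree (\sum_i m * (q i - 1) + 1 * (m - 1)) P.
  apply: set_degreeM; last first.
    by apply: set_degree_bin; apply: set_degreeD => //; exact: set_degree_const.
  apply: set_degree_prod => i; apply: set_degree_bin.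
  by apply: set_degreeD => //; exact: set_degree_const.
have lt_deg : \sum_i m * (q i - 1) + 1 * (m - 1) < #|{: I}|.
  rewrite card_ord (leq_trans _ leS) // -big_distrr /= mulnDr muln1 mul1n; lia.
have P0 : ~~ (p %| P set0).
  rewrite /P cards0 add0n binn muln1 big1 ?dvdn1 ?neq_ltn ?prime_gt1 ?orbT // => i _.
  rewrite {1}/e big1 ?add0n ?binn // => K /eqP Km.
  (* Since m > 0, no set of m indices lies in [set0], so [e i set0] is 0. *)
  by rewrite subset0 -cards_eq0 Km gtn_eqF.
have [J J_neq0] := exists_ndvdn_set_degree lt_deg deg_P P0.
rewrite /P Euclid_dvdM // negb_or => /andP[NpJ].
move/(dvdn_of_ndvdn_bin p_pr) => /dvdn_leq; rewrite card_gt0 => /(_ J_neq0) mJ.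
exists [seq (S`_j)%R | j : I <- enum J]; split.
(* Both lists are images of lists of ordinals, and [enum J] is a filter of the full enumeration. *)
- suff: subseq [seq (S`_j)%R | j : I <- enum J] (mkseq (nth 0%R S) (size S)).
    by rewrite mkseq_nth.
  rewrite /mkseq -val_enum_ord -map_comp.
  by apply: map_subseq; rewrite enumT; apply: filter_subseq.
- by rewrite size_map -cardE.
apply: dsum_componentP => i; rewrite dsum_component0 esym_component -map_comp.
rewrite esym_map_uniq ?enum_uniq //.
transitivity ((e i J)%:R : 'Z_(q i))%R; last first.
  apply/eqP; rewrite natr_Zp_eq0 //; apply: (dvdn_of_ndvdn_bin p_pr).
  by apply: contra NpJ => pe; rewrite (bigD1 i) //= dvdn_mulr.
rewrite /e natr_sum big_mkcondl; apply: eq_bigr => K _.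
rewrite (eq_subset_r (mem_enum J)); case: ifP => _; last by rewrite mul0n.
rewrite mul1n natr_prod; apply: eq_bigr => j _.
by rewrite /a /= natr_Zp.
Qed.

(** * The lower bound *)

Definition step_vector (j : nat) : A := [ffun i : 'I_r => ((j <= i.+1)%N%:R)%R].

(** Indices are listed instead of vectors because [step_vector 0] and [step_vector 1] are both the
    unit; keeping them apart gives the induction its base case. *)
Definition step_indices : seq nat :=
  nseq (m - 1) 0 ++ flatten [seq nseq (m * (q i - 1)) i.+1 | i : 'I_r <- enum 'I_r].

Lemma size_step_indices : (size step_indices).+1 = m * (\sum_(i < r) (q i - 1) + 1).
Proof.
rewrite size_cat size_nseq size_flatten /shape -map_comp sumnE big_map big_enum /=.
under eq_bigr do rewrite size_nseq.
by rewrite -big_distrr /= mulnDr muln1 -addSn subn1 prednK // addnC.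
Qed.

Lemma count_step_indices0 : count_mem 0 step_indices = m - 1.
Proof.
rewrite count_cat count_nseq /= mul1n count_flatten -map_comp sumnE big_map.
by rewrite big1 ?addn0 // => i _; rewrite /= count_nseq.
Qed.

Lemma count_step_indicesS (i : 'I_r) :
  count_mem i.+1 step_indices = m * (q i - 1).
Proof.
rewrite count_cat count_nseq /= mul0n count_flatten -map_comp sumnE big_map.
rewrite big_enum (bigD1 i) //= count_nseq /= eqxx mul1n big1 ?addn0 // => j ji.
by rewrite count_nseq /= eqSS val_eqE (negPf ji).
Qed.

Lemma step_indices_le : all (fun j => j <= r) step_indices.
Proof.
rewrite all_cat all_nseq leq0n orbT /=; apply/allP => j /flatten_mapP[i _].
by rewrite mem_nseq => /andP[_ /eqP->].
Qed.

Lemma esym_step_vector_neq0 (t : seq nat) : subseq t step_indices -> m <= size t ->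
  Defs.esym m (map step_vector t) != 0%R.
Proof.
move=> sub_t; apply: contraTneq => et0; rewrite -ltnNge.
have -> : size t = count (fun j => j <= r) t.
  apply/esym/eqP; rewrite -all_count; apply/allP => j /(mem_subseq sub_t).
  exact: (allP step_indices_le).
have le_count j : count_mem j t <= count_mem j step_indices by exact: leq_count_subseq.
suff : forall k, k <= r -> count (fun j => j <= k) t < m by apply.
elim=> [_|k IHk kr].
  rewrite (eq_count (a2 := pred1 0)); last by move=> j; rewrite leqn0.
  by rewrite (leq_ltn_trans (le_count 0)) // count_step_indices0; lia.
pose i := Ordinal kr.
(* At most m - 1 entries up to [k] and m (q_i - 1) entries equal to [k.+1] make fewer than m q_i. *)
have lt_count : count (fun j => j <= k.+1) t < m * q i.
  have -> : count (fun j => j <= k.+1) t = count (fun j => j <= k) t + count_mem k.+1 t.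
    elim: (t) => //= j t' ->; have := ltngtP j k.+1; lia.
  have := IHk (ltnW kr); have := le_count i.+1; rewrite count_step_indicesS /=.
  have := q_gt1 i; nia.
rewrite ltnNge; apply: contraL lt_count => mk; rewrite -leqNgt -expnD.
apply: pexp_leq_of_dvdn_bin => //; rewrite -natr_Zp_eq0 //.
(* In component [i] the chosen vectors become a 0/1 sequence whose ones are the entries
   [j <= k.+1]. *)
have := congr1 (dsum_component i) et0.
rewrite dsum_component0 esym_component -map_comp => <-.
rewrite -(count_map (fun j => j <= k.+1) id) -esym_bool -map_comp.
apply/eqP; congr Defs.esym; apply: eq_map => j /=.
by rewrite /dsum_component ffunE.
Qed.

Lemma davenport_esym_dsum_Zp :
  davenport_esym m A = m * (\sum_(i < r) (q i - 1) + 1).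
Proof.
apply/least_posP; first by rewrite muln_gt0 m_gt0 addn1.
split=> [|t _ Pt]; first exact: exists_subseq_esym_eq0.
rewrite leqNgt -size_step_indices ltnS; apply/negP => le_t.
have /(_ _)[|S' [/subseqP[b _ ->]]] := Pt (map step_vector step_indices).
  by rewrite size_map.
rewrite -map_mask size_map => mS' S'0.
by have := esym_step_vector_neq0 (mask_subseq b _) mS'; rewrite S'0 eqxx.
Qed.

End PrimePower.

Theorem theorem15 (p s r : nat) (alpha : 'I_r -> nat) :
  prime p -> 0 < r -> (forall i : 'I_r, 0 < alpha i) ->
  let A : finComPzRingType :=
    dsum_ring (fun i : 'I_r => ('Z_(p ^ alpha i) : finComPzRingType)) in
  davenport_esym (p ^ s) A = p ^ s * (\sum_(i < r) (p ^ alpha i - 1) + 1)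
  /\ p ^ s * (\sum_(i < r) (p ^ alpha i - 1) + 1) = p ^ s * davenport A.
Proof.
move=> p_pr _ alpha_gt0 A; split; first exact: davenport_esym_dsum_Zp.
by rewrite -davenport_esym1 -(expn0 p) davenport_esym_dsum_Zp // expn0 mul1n.
Qed.
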